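(* Let $G$ be a group and let $R$ be a $G$-graded ring. If $(R,G)$ is a weakly crossed product, then $(R,G)$ is weak.
   Context: A ring $R$ with unity $1$ is $G$-graded if $R=\bigoplus_{g\in G}R_g$ for additive subgroups $R_g$ with $R_gR_h\subseteq R_{gh}$ for all $g,h\in G$. $supp(R,G)=\{g\in G:R_g\neq\{0\}\}$. $(R,G)$ is a weakly crossed product if $R_g$ contains a unit of $R$ for every $g\in supp(R,G)$. $(R,G)$ is weak if for every $g\in G$, $R_g=\{0\}$ implies $R_{g^{-1}}=\{0\}$. *)

(* Defs.v *)
From HB Require Import structures.
From mathcomp Require Import all_boot all_algebra.
From mathcomp Require Import boolp classical_sets functions cardinality fsbigop.

Set Implicit Arguments.
Unset Strict Implicit.
Unset Printing Implicit Defensive.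

Import GRing.Theory.
Local Open Scope classical_set_scope.
Local Open Scope ring_scope.

(* Two-sided invertibility, as a property: a [pzRingType] does not come with
   the decidable predicate [GRing.unit] of a [unitRingType]. *)
Definition is_ring_unit (R : pzRingType) (u : R) : Prop :=
  exists v : R, u * v = 1 /\ v * u = 1.

(* The finiteness condition cannot be dropped: [\sum_(g \in D) f g] is 0 when
   f has infinite support in D. *)
Definition internal_direct_sum (G : choiceType) (V : zmodType)
    (A : G -> set V) : Prop :=
  forall r : V, exists! f : G -> V,
    [/\ forall g, A g (f g),
        finite_set [set g | f g != 0]
      & r = \sum_(g \in [set: G]) f g].

Record is_graded (G : groupType) (R : pzRingType) (A : G -> set R) : Prop := {
  graded_zmod : forall g, GRing.zmod_closed (mem (A g));
  graded_sum : internal_direct_sum A;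
  graded_mul : forall (g h : G) (x y : R),
    A g x -> A h y -> A (g * h)%g (x * y)
}.

Definition graded_supp (G : groupType) (R : pzRingType) (A : G -> set R) :
    set G :=
  [set g | A g <> [set 0]].

Definition weakly_crossed_product (G : groupType) (R : pzRingType)
    (A : G -> set R) : Prop :=
  forall g, graded_supp A g -> exists2 u : R, A g u & is_ring_unit u.

Definition weak_grading (G : groupType) (R : pzRingType) (A : G -> set R) :
    Prop :=
  forall g : G, A g = [set 0] -> A (g^-1)%g = [set 0].

(* Main.v *)
Require Import Defs.
From mathcomp Require Import all_boot all_algebra.
From mathcomp Require Import classical_sets.
From mathcomp Require Import boolp functions cardinality fsbigop.

Set Implicit Arguments.
Unset Strict Implicit.
Unset Printing Implicit Defensive.

(** Let [u] be a unit of degree [g^-1] with inverse [v]. Comparing components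
    of degree [1] in [1 = u * v] gives [1_1 = u * v_g], which vanishes when
    [A g] is zero. Comparing components of degree [h] in [x = x * 1], for [x]
    of degree [h], then gives [x = x * 1_1 = 0], so the whole ring is zero. *)

Import GRing.Theory.
Local Open Scope classical_set_scope.
Local Open Scope ring_scope.

(** The predicate under [exists!] in [internal_direct_sum], named so that existence and uniqueness
    can be used separately. *)
Definition homogeneous_decomposition (G : choiceType) (V : zmodType)
    (A : G -> set V) (r : V) (f : G -> V) : Prop :=
  [/\ forall g, A g (f g),
      finite_set [set g | f g != 0]
    & r = \sum_(g \in [set: G]) f g].

Section Grading.
Variables (G : groupType) (R : pzRingType) (A : G -> set R).
Hypothesis gradedA : is_graded A.

Lemma graded0 g : A g 0.
Proof. by have [] := graded_zmod gradedA g; rewrite inE. Qed.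

Lemma homogeneous_decomposition_exists r :
  exists f, homogeneous_decomposition A r f.
Proof. by have [f [decf _]] := graded_sum gradedA r; exists f. Qed.

Lemma homogeneous_decomposition_unique r f f' :
  homogeneous_decomposition A r f -> homogeneous_decomposition A r f' ->
  f = f'.
Proof.
have [f0 [_ uniq_f0]] := graded_sum gradedA r.
by move=> /uniq_f0 <- /uniq_f0 <-.
Qed.

Lemma homogeneous_decomposition_pure h x :
  A h x ->
  homogeneous_decomposition A x (fun k => if k == h then x else 0).
Proof.
move=> Ahx; split.
- by move=> k; case: eqP => [->|_] //; apply: graded0.
- apply: (sub_finite_set _ (finite_set1 h)) => k /=.
  by have [|_] := eqVneq k h; last rewrite eqxx.
- rewrite -(fsbig_widen [set h]) ?fsbig_set1 ?eqxx // => k [_ /= /eqP].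
  by move=> /negbTE ->.
Qed.

(** Left multiplication by [x] carries degree [h^-1 * k] into degree [k], so it translates a
    decomposition by [h]. *)
Lemma homogeneous_decompositionMl h x y f :
  A h x -> homogeneous_decomposition A y f ->
  homogeneous_decomposition A (x * y) (fun k => x * f (h^-1 * k)%g).
Proof.
move=> Ahx [Af finf ->].
have bij_shift : bijective (fun k : G => h^-1 * k)%g.
  by exists (fun k : G => h * k)%g; [apply: mulVKg | apply: mulKg].
split.
- by move=> k; rewrite -{1}(mulVKg h k); apply: (graded_mul gradedA).
- apply: (@sub_finite_set _ _
    ((fun k : G => h^-1 * k)%g @^-1` [set g | f g != 0])).
    by move=> k /=; apply: contra_neq => ->; rewrite mulr0.
  by apply: finite_preimage => // k k' _ _; apply: (bij_inj bij_shift).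
(* Undo the translation, then distribute [x]. Distributing needs the finite support of [f]: over an
   infinite support the sum is 0 by default. *)
- rewrite -(reindex_fsbigT _ (fun k => x * f k) bij_shift).
  apply: full_fsbig_distrr; apply: sub_finite_set finf => k /= [_].
  by move=> /eqP.
Qed.

Lemma homogeneous_mul_component1 h x e :
  A h x -> homogeneous_decomposition A 1 e -> x = x * e 1%g.
Proof.
move=> Ahx /(homogeneous_decompositionMl Ahx); rewrite mulr1 => decx.
have := homogeneous_decomposition_unique
  (homogeneous_decomposition_pure Ahx) decx.
(* At [h] the pure decomposition is [x], while the translated one reads [e] at [h^-1 * h = 1]. *)
by move=> /(congr1 (fun f => f h)); rewrite eqxx mulVg.
Qed.

End Grading.

Theorem proposition4p9 (G : groupType) (R : pzRingType) (A : G -> set R)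
    (gradedA : is_graded A) (wcpA : weakly_crossed_product A) :
  weak_grading A.
Proof.
move=> g Ag0; apply: contrapT => suppVg.
have [u Au [v [uv1 _]]] := wcpA _ suppVg.
have [e dec1] := homogeneous_decomposition_exists gradedA 1.
have [f decv] := homogeneous_decomposition_exists gradedA v.
have e1_eq0 : e 1%g = 0.
  (* As [u] has degree [g^-1], the degree [1] component of [u * v] is [u * f g], and [f g] lies in
     [A g], which is zero. *)
  have := homogeneous_decompositionMl gradedA Au decv.
  rewrite uv1 => /(homogeneous_decomposition_unique gradedA dec1) ->.
  rewrite mulg1 invgK; case: decv => /(_ g) + _ _.
  by rewrite Ag0 => ->; rewrite mulr0.
(* The collapse is only invoked in degree [g^-1], where it contradicts [suppVg]. *)
apply: suppVg; apply/seteqP; split=> [x Ax|x ->] /=; last exact: graded0.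
rewrite (homogeneous_mul_component1 gradedA Ax dec1).
by rewrite e1_eq0 mulr0.
Qed.
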